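(* Let $T\in A\otimes B\otimes C$, with $\dim A=\dim B=\dim C=m$, be a skeletal tensor. Then the border rank of $T$ satisfies $\underline{\mathbf R}(T)\ge m+1$ unless $T$ is isomorphic to the big Coppersmith-Winograd tensor $T_{CW,m-2}$.
   Context: All vector spaces are over $\mathbb C$, and $m\ge2$ (so that the tensors below make sense). $(a_i),(b_i),(c_i)$, $1\le i\le m$, are bases of $A,B,C$. For a bilinear form $\mathcal B\in\langle a_2,\dots,a_{m-1}\rangle\otimes\langle b_2,\dots,b_{m-1}\rangle$ put $$S_{\mathcal B}= a_1\otimes b_1\otimes c_m+a_1\otimes b_m\otimes c_1+a_m\otimes b_1\otimes c_1+\sum_{\rho=2}^{m-1}a_1\otimes b_\rho\otimes c_\rho+\sum_{\rho=2}^{m-1}a_\rho\otimes b_1\otimes c_\rho+\mathcal B\otimes c_1 .$$ A tensor is skeletal if it is of the form $S_{\mathcal B}$, in some bases, for some nondegenerate (i.e. full rank $m-2$) bilinear form $\mathcal B$. The big Coppersmith-Winograd tensor is $T_{CW,m-2}=S_{\mathcal B}$ with $\mathcal B=\sum_{\rho=2}^{m-1}a_\rho\otimes b_\rho$. Two tensors are isomorphic if they lie in the same $GL(A)\times GL(B)\times GL(C)$-orbit. The rank of a tensor is the smallest $r$ such that it is a sum of $r$ tensors of the form $a\otimes b\otimes c$; the border rank $\underline{\mathbf R}(T)$ is the smallest $r$ such that $T$ is a limit of tensors of rank $r$ (equivalently, of rank at most $r$). *)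

(* Defs.v *)
From mathcomp Require Import all_boot all_order all_algebra.
From mathcomp Require Import all_classical all_reals all_analysis.
From mathcomp Require Export complex.

Set Implicit Arguments.
Unset Strict Implicit.
Unset Printing Implicit Defensive.

Import Order.TTheory GRing.Theory Num.Theory.
Import numFieldNormedType.Exports.

Local Open Scope classical_set_scope.
Local Open Scope ring_scope.

(* A (x) B (x) C with A = B = C = K^m (row vectors), as arrays of coordinates:
   T (i, j, k) is the coefficient of e_i (x) e_j (x) e_k.  The codomain K^o,
   K as a module over itself, makes tensors an lmodType over K. *)
Definition tensor (K : numFieldType) (m : nat) : Type :=
  {ffun 'I_m * 'I_m * 'I_m -> K^o}.

Section Tensors.
Variables (K : numFieldType) (m : nat).
Implicit Types (T : tensor K m) (u v w : 'rV[K]_m).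

Definition pure_tensor u v w : tensor K m :=
  [ffun x => u 0 x.1.1 * v 0 x.1.2 * w 0 x.2].

Definition sum_of_pure T (r : nat) : Prop :=
  exists u v w : 'I_r -> 'rV[K]_m,
    T = \sum_(l < r) pure_tensor (u l) (v l) (w l).

Lemma sum_of_pure_exists T : exists r, `[< sum_of_pure T r >].
Proof.
exists #|{: 'I_m * 'I_m * 'I_m}|; apply/asboolP.
pose e (i : 'I_m) : 'rV[K]_m := delta_mx 0 i.
exists (fun l => T (enum_val l) *: e (enum_val l).1.1),
  (fun l => e (enum_val l).1.2), (fun l => e (enum_val l).2).
rewrite -(reindex (@enum_val {: 'I_m * 'I_m * 'I_m} predT) (P := predT)
  (F := fun x => pure_tensor (T x *: e x.1.1) (e x.1.2) (e x.2))); last first.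
  by apply: onW_bij; exact: enum_val_bij.
apply/ffunP => -[[i j] k].
rewrite sum_ffunE (bigD1 (i, j, k)) //= big1 => [|[[i' j'] k'] /=].
  by rewrite addr0 ffunE !mxE /= !eqxx !mulr1.
rewrite !ffunE !mxE /= !xpair_eqE.
rewrite (eq_sym i) (eq_sym j) (eq_sym k).
by do 3 case: (_ == _) => //=; rewrite ?(mulr0, mul0r).
Qed.

Definition tensor_rank T : nat := ex_minn (sum_of_pure_exists T).

Definition limit_of_rank T (r : nat) : Prop :=
  exists2 Ts : nat -> tensor K m, (forall n, tensor_rank (Ts n) = r) &
    forall x, (fun n => Ts n x) @ \oo --> T x.

Lemma limit_of_rank_exists T : exists r, `[< limit_of_rank T r >].
Proof.
exists (tensor_rank T); apply/asboolP; exists (fun=> T) => // x.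
exact: cvg_cst.
Qed.

Definition border_rank T : nat := ex_minn (limit_of_rank_exists T).

(* Row vectors are acted on from the right, so that row i P is the image of
   the basis vector e_i under P. *)
Definition tensor_act (P Q S : 'M[K]_m) T : tensor K m :=
  \sum_x T x *: pure_tensor (row x.1.1 P) (row x.1.2 Q) (row x.2 S).

Definition isomorphic T T' : Prop :=
  exists P Q S : 'M[K]_m,
    [/\ P \in unitmx, Q \in unitmx, S \in unitmx & T' = tensor_act P Q S T].

End Tensors.

Section Skeletal.
Variables (K : numFieldType) (q : nat).
Local Notation m := q.+2.

(* 'I_m counts from 0: the indices 1, m and 2 <= rho <= m - 1 of the basis
   vectors become ord0, ord_max and mid rho with rho : 'I_q. *)
Definition mid (rho : 'I_q) : 'I_m := lift ord0 (lift ord_max rho).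

(* The matrix B holds the coefficients of the bilinear form
   \sum_(rho, s) B rho s a_(mid rho) (x) b_(mid s). *)
Definition skeletal_form (a b c : m.-tuple 'rV[K]_m) (B : 'M[K]_q) :
    tensor K m :=
  let: a_ := tnth a in let: b_ := tnth b in let: c_ := tnth c in
  pure_tensor (a_ ord0) (b_ ord0) (c_ ord_max)
  + pure_tensor (a_ ord0) (b_ ord_max) (c_ ord0)
  + pure_tensor (a_ ord_max) (b_ ord0) (c_ ord0)
  + \sum_(rho < q) pure_tensor (a_ ord0) (b_ (mid rho)) (c_ (mid rho))
  + \sum_(rho < q) pure_tensor (a_ (mid rho)) (b_ ord0) (c_ (mid rho))
  + \sum_(rho < q) \sum_(s < q)
      B rho s *: pure_tensor (a_ (mid rho)) (b_ (mid s)) (c_ ord0).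

Definition skeletal (T : tensor K m) : Prop :=
  exists (a b c : m.-tuple 'rV[K]_m) (B : 'M[K]_q),
    [/\ basis_of fullv a, basis_of fullv b, basis_of fullv c,
        \rank B = q & T = skeletal_form a b c B].

Definition std_basis : m.-tuple 'rV[K]_m := [tuple delta_mx 0 i | i < m].

Definition big_CW : tensor K m :=
  skeletal_form std_basis std_basis std_basis 1%:M.

End Skeletal.

Arguments big_CW : clear implicits.

(* Main.v *)
Require Import Defs.
From HB Require Import structures.
From mathcomp Require Import all_boot all_order all_algebra.
From mathcomp Require Import all_classical all_reals all_analysis.
From mathcomp Require Import complex.

(** If T has border rank at most m, its slices X_i along the first factor
    satisfy Strassen's equations
      X_i X_j^-1 X_k = X_k X_j^-1 X_i  whenever X_j is invertible:
    for a tensor of rank at most m one has X_i = V D_i W with D_i diagonal, and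
    after clearing denominators the identity is polynomial, so it passes to
    limits. In the bases defining S_B the slice X_1 is invertible and the
    product X_rho X_1^-1 X_s has B(s, rho) as its only nonzero coefficient, so
    B is symmetric. A nondegenerate symmetric form over an algebraically closed
    field is congruent to the identity; letting the congruence act on the middle
    basis vectors of A and B, and its inverse transpose on those of C, turns
    S_B into the big Coppersmith-Winograd tensor. *)

Set Implicit Arguments.
Unset Strict Implicit.
Unset Printing Implicit Defensive.

Import Order.TTheory GRing.Theory Num.Theory.
Import numFieldNormedType.Exports.

Local Open Scope classical_set_scope.
Local Open Scope ring_scope.

(** * Symmetric bilinear forms up to congruence *)

Section SymmetricForms.
Variable K : numClosedFieldType.

Lemma entry_mulmx n (B : 'M[K]_n) (i j : 'I_n) :
  ((delta_mx 0 i : 'rV_n) *m B *m (delta_mx 0 j : 'rV_n)^T) 0 0 = B i j.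
Proof. by rewrite -rowE trmx_delta -colE !mxE. Qed.

(** Polarization: if the quadratic form vanishes everywhere, its value at [e i + e j] is twice
    [B i j], so [B] is zero in characteristic zero. *)
Lemma sym_neq0_anisotropic n (B : 'M[K]_n) :
  B^T = B -> B != 0 -> exists v : 'rV[K]_n, (v *m B *m v^T) 0 0 != 0.
Proof.
move=> symB nzB; apply: contrapT => isoB.
have qE (v : 'rV[K]_n) : (v *m B *m v^T) 0 0 = 0.
  by apply/eqP/negP => /negP vB; apply: isoB; exists v.
case/negP: nzB; apply/eqP/matrixP => i j; rewrite mxE.
pose e k : 'rV[K]_n := delta_mx 0 k.
have bE k l : (e k *m B *m (e l)^T) 0 0 = B k l by exact: entry_mulmx.
have Bij : B i j = B j i by rewrite -{1}symB mxE.
have := qE (e i + e j).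
have mxD (M M' : 'M[K]_1) : (M + M') 0 0 = M 0 0 + M' 0 0 by rewrite mxE.
rewrite [(_ + _)^T]linearD /= !mulmxDl !mulmxDr !mxD !bE -Bij.
have -> : B i i = 0 by rewrite -bE qE.
have -> : B j j = 0 by rewrite -bE qE.
by rewrite add0r addr0 -mulr2n => /eqP; rewrite mulrn_eq0 /= => /eqP.
Qed.

(** One step of symmetric Gaussian elimination: a square root scales the pivot [B 0 0] to 1, the
    rest of its row and column is cleared, and [S] is the Schur complement. *)
Lemma sym_schur n (B : 'M[K]_(1 + n)) :
    B^T = B -> B 0 0 != 0 ->
  exists (L : 'M[K]_(1 + n)) (S : 'M[K]_n),
    [/\ L \in unitmx, S^T = S & L *m B *m L^T = block_mx 1%:M 0 0 S].
Proof.
set b := B 0 0 => symB nz_b; pose u := ursubmx B; pose c := (sqrtC b)^-1.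
have bE : ulsubmx B = b%:M.
  by apply/matrixP => i j; rewrite !ord1 !mxE /b; congr (B _ _); apply: val_inj.
have uE : dlsubmx B = u^T by rewrite trmx_ursub symB.
have BE : B = block_mx b%:M u u^T (drsubmx B) by rewrite -bE -uE submxK.
exists (block_mx c%:M 0 (- b^-1 *: u^T) 1%:M), (drsubmx B - b^-1 *: (u^T *m u)).
split.
- rewrite unitmxE det_lblock !det_scalar1 det1 mulr1 unitfE.
  by rewrite invr_eq0 sqrtC_eq0.
- by rewrite linearB linearZ /= trmx_mul trmxK trmx_drsub symB.
have cb : c * b = sqrtC b.
  by rewrite /c -[X in _ * X]sqrtCK expr2 mulrA mulVf ?mul1r // sqrtC_eq0.
rewrite {1}BE tr_block_mx !mulmx_block.
rewrite !(mul0mx, mulmx0, mul1mx, mulmx1, trmx0, trmx1, addr0).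
rewrite linearZ /= trmxK tr_scalar_mx -!scalemxAl !mul_scalar_mx !mul_mx_scalar.
have -> : - b^-1 *: (b *: u^T) + u^T = 0.
  by rewrite scalerA mulNr mulVf // scaleN1r addNr.
rewrite mul0mx add0r scaler0 !scale_scalar_mx mul_scalar_mx scalerA cb.
have -> : c * sqrtC b = 1 by rewrite mulVf // sqrtC_eq0.
by rewrite -cb mulrN mulfK // scaleNr addNr scaleNr addrC.
Qed.

Lemma sym_unitmx_congr1 n (B : 'M[K]_n) :
  B^T = B -> B \in unitmx -> exists H : 'M[K]_n, H *m B *m H^T = 1%:M.
Proof.
elim: n => [|n IHn] in B * => symB uB.
  by exists 1%:M; apply/matrixP => -[].
have [v vB] : exists v : 'rV[K]_n.+1, (v *m B *m v^T) 0 0 != 0.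
  apply: sym_neq0_anisotropic => //; apply: contraTneq uB => ->.
  by rewrite unitmxE det0 unitr0.
(* [v] becomes the first vector of a basis, the rows of [N]: the rank-one map [f] sends [e] to [v],
   and [complete_unitmx] replaces it by an invertible one. *)
have [N uN vE] : {N : 'M[K]_n.+1 | N \in unitmx & v = delta_mx 0 0 *m N}.
  pose e : 'rV[K]_n.+1 := delta_mx 0 0; pose f : 'M[K]_n.+1 := e^T *m v.
  have fE : e *m f = v.
    rewrite /f mulmxA trmx_delta mul_delta_mx.
    rewrite -[delta_mx 0 0](_ : 1%:M = _) ?mul1mx //.
    by apply/matrixP => i j; rewrite !mxE !ord1.
  have [|N uN vE] := @complete_unitmx _ _ _ e f.
    rewrite fE mxrank_delta rank_rV; apply/eqP; rewrite eqb1.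
    by apply: contraNneq vB => ->; rewrite !mul0mx mxE.
  by exists N; rewrite // -vE fE.
have [||L [S [uL symS LE]]] := @sym_schur n (N *m B *m N^T).
- by rewrite !trmx_mul trmxK symB mulmxA.
(* The pivot of [N *m B *m N^T] is the value of the form at [v]. *)
- apply: contraNneq vB; rewrite vE -entry_mulmx => <-.
  by rewrite !trmx_mul !mulmxA.
have uS : S \in unitmx.
  have : L *m (N *m B *m N^T) *m L^T \in unitmx.
    by rewrite !unitmx_mul !unitmx_tr uL uN uB.
  by rewrite LE !unitmxE det_ublock det1 mul1r.
have [H HS] := IHn S symS uS.
pose G : 'M[K]_(1 + n) := block_mx 1%:M 0 0 H; exists (G *m L *m N).
transitivity (G *m block_mx 1%:M 0 0 S *m G^T).
  by rewrite -LE !trmx_mul !mulmxA.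
rewrite /G tr_block_mx !trmx0 trmx1 !mulmx_block.
by rewrite !(mulmx0, mul0mx, mul1mx, mulmx1, addr0, add0r) HS -scalar_mx_block.
Qed.
End SymmetricForms.

(** * Slices and Strassen's equations *)

Section Strassen.
Variables (K : numFieldType) (m : nat).
Implicit Types T : tensor K m.

Definition slice T (i : 'I_m) : 'M[K]_m := \matrix_(j, k) T (i, j, k).

(** [V] and [W] collect the second and third factors of the pure tensors; the first factors enter
    only through the diagonal. *)
Lemma slice_sum_of_pure T r : sum_of_pure T r ->
  exists (V : 'M[K]_(m, r)) (d : 'I_m -> 'rV[K]_r) (W : 'M[K]_(r, m)),
    forall i, slice T i = V *m diag_mx (d i) *m W.
Proof.
case=> u [v [w ->]].
exists (\matrix_(j, l) v l 0 j), (fun i => \row_l u l 0 i),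
  (\matrix_(l, k) w l 0 k) => i.
apply/matrixP => j k; rewrite mul_mx_diag !mxE sum_ffunE; apply: eq_bigr => l _.
by rewrite ffunE !mxE /= (mulrC (v l 0 j)).
Qed.

Lemma slice_strassen T r (i j k : 'I_m) :
    sum_of_pure T r -> (r <= m)%N -> slice T j \in unitmx ->
  slice T i *m invmx (slice T j) *m slice T k =
  slice T k *m invmx (slice T j) *m slice T i.
Proof.
move=> /slice_sum_of_pure[V [d [W TE]]] le_rm uj.
(* An invertible slice factors through dimension [r], which forces [r >= m]; then [V], [W] and
   [diag_mx (d j)] are square and invertible. *)
have mr : r = m.
  apply/eqP; rewrite eqn_leq le_rm -(mxrank_unit uj) TE.
  apply: leq_trans (mxrankM_maxl _ _) _.
  exact: leq_trans (mxrankM_maxl _ _) (rank_leq_col _).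
subst r.
move: uj; rewrite !TE !unitmx_mul => /andP[/andP[uV ud] uW].
have dE : invmx (V *m diag_mx (d j) *m W) =
    invmx W *m invmx (diag_mx (d j)) *m invmx V.
  apply: (row_full_inj (A := V *m diag_mx (d j) *m W)).
    by rewrite row_full_unit !unitmx_mul uV ud uW.
  rewrite mulmxV ?unitmx_mul ?uV ?ud ?uW // !mulmxA mulmxK //.
  by rewrite mulmxK // mulmxV.
have side a b : V *m diag_mx (d a) *m W *m
    (invmx W *m invmx (diag_mx (d j)) *m invmx V) *m (V *m diag_mx (d b) *m W)
    = V *m (diag_mx (d a) *m invmx (diag_mx (d j)) *m diag_mx (d b)) *m W.
  by rewrite !mulmxA mulmxK // mulmxKV.
rewrite dE !side; congr (V *m _ *m W).
(* Commutation with [diag_mx (d j)] passes to its inverse. *)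
have com a : comm_mx (diag_mx (d a)) (invmx (diag_mx (d j))).
  rewrite /comm_mx -{1}(mulmxK ud (invmx _ *m _)) ?mulmxA.
  by rewrite -(mulmxA (invmx _)) diag_mx_comm mulmxA mulVmx // mul1mx.
rewrite com -mulmxA diag_mx_comm mulmxA.
by rewrite -com.
Qed.


Lemma cvg_mulmx n p s (A_ : nat -> 'M[K]_(n, p)) (B_ : nat -> 'M[K]_(p, s))
    (A : 'M[K]_(n, p)) (B : 'M[K]_(p, s)) :
    (forall i j, A_ t i j @[t --> \oo] --> A i j) ->
    (forall i j, B_ t i j @[t --> \oo] --> B i j) ->
  forall i j, (A_ t *m B_ t) i j @[t --> \oo] --> (A *m B) i j.
Proof.
move=> cA cB i j; rewrite mxE; under eq_cvg do rewrite mxE.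
apply: cvg_big => [|l _]; first exact: add_continuous.
exact: cvgM.
Qed.

Lemma cvg_det n (A_ : nat -> 'M[K]_n) (A : 'M[K]_n) :
    (forall i j, A_ t i j @[t --> \oo] --> A i j) ->
  \det (A_ t) @[t --> \oo] --> \det A.
Proof.
move=> cA; apply: cvg_big => [|s _]; first exact: add_continuous.
apply: cvgM; first exact: cvg_cst.
by apply: cvg_big => [|i _]; first exact: mul_continuous.
Qed.

Lemma cvg_adj n (A_ : nat -> 'M[K]_n) (A : 'M[K]_n) :
    (forall i j, A_ t i j @[t --> \oo] --> A i j) ->
  forall i j, (\adj (A_ t)) i j @[t --> \oo] --> (\adj A) i j.
Proof.
move=> cA i j; rewrite mxE; under eq_cvg do rewrite mxE.
apply: cvgM; first exact: cvg_cst.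
apply: cvg_det => i' j'; rewrite !mxE; under eq_cvg do rewrite !mxE.
exact: cA.
Qed.

(* Clearing denominators turns [slice_strassen] into a polynomial identity,
   which holds also where the middle slice is singular and passes to limits. *)
Lemma slice_strassen_poly T r (i j k : 'I_m) :
    sum_of_pure T r -> (r <= m)%N ->
  \det (slice T j) *: (slice T i *m \adj (slice T j) *m slice T k) =
  \det (slice T j) *: (slice T k *m \adj (slice T j) *m slice T i).
Proof.
move=> Tr le_rm; have [uj|] := boolP (slice T j \in unitmx); last first.
  by rewrite unitmxE unitfE negbK => /eqP->; rewrite !scale0r.
have adjE : \adj (slice T j) = \det (slice T j) *: invmx (slice T j).
  by rewrite /invmx uj scalerA divff ?scale1r // -unitfE -unitmxE.
by rewrite adjE -!scalemxAr -!scalemxAl (slice_strassen _ _ Tr).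
Qed.

(** Both sides of [slice_strassen_poly] are continuous in the entries, so they agree in the limit,
    where the determinant is nonzero and cancels. *)
Lemma slice_strassen_lim (Ts : nat -> tensor K m) T r (i j k : 'I_m) :
    (forall t, sum_of_pure (Ts t) r) ->
    (forall x, Ts t x @[t --> \oo] --> T x) -> (r <= m)%N ->
    slice T j \in unitmx ->
  slice T i *m invmx (slice T j) *m slice T k =
  slice T k *m invmx (slice T j) *m slice T i.
Proof.
move=> Tsr cT le_rm uj.
have cS l a b : slice (Ts t) l a b @[t --> \oo] --> slice T l a b.
  by rewrite mxE; under eq_cvg do rewrite mxE; exact: cT.
have cP a b c d : (\det (slice (Ts t) j) *:
      (slice (Ts t) a *m \adj (slice (Ts t) j) *m slice (Ts t) b)) c d
    @[t --> \oo] -->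
    (\det (slice T j) *: (slice T a *m \adj (slice T j) *m slice T b)) c d.
  rewrite mxE; under eq_cvg do rewrite mxE.
  apply: cvgM; first exact: cvg_det.
  by apply: cvg_mulmx => //; apply: cvg_mulmx => //; exact: cvg_adj.
have nz : \det (slice T j) != 0 by rewrite -unitfE -unitmxE.
rewrite /invmx uj -!scalemxAr -!scalemxAl; congr (_ *: _).
apply: (scalerI nz); apply/matrixP => c d.
have := cP i k c d.
under eq_cvg do rewrite (slice_strassen_poly i j k (Tsr _) le_rm).
by move=> cik; exact: (cvg_unique (@norm_hausdorff _ K^o) cik (cP k i c d)).
Qed.

End Strassen.

(** * Change of bases *)

Section TensorAction.
Variables (K : numFieldType) (m : nat) (P Q S : 'M[K]_m).
Implicit Types T : tensor K m.

Lemma tensor_act_is_linear :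
  linear (tensor_act P Q S : tensor K m -> tensor K m).
Proof.
move=> c T T'; rewrite /tensor_act scaler_sumr -big_split /=.
by apply: eq_bigr => x _; rewrite !ffunE scalerDl scalerA.
Qed.

HB.instance Definition _ := GRing.isLinear.Build K (tensor K m) (tensor K m) _
  (tensor_act P Q S) tensor_act_is_linear.

Lemma tensor_act_pure (u v w : 'rV[K]_m) :
  tensor_act P Q S (pure_tensor u v w) =
  pure_tensor (u *m P) (v *m Q) (w *m S).
Proof.
apply/ffunP => -[[i j] k]; rewrite sum_ffunE ffunE /= !mxE.
rewrite big_distrlr /= pair_big /= big_distrlr /= pair_big /=.
apply: eq_bigr => -[[a b] c] _; rewrite !ffunE /= !mxE /GRing.scale /=.
by rewrite mulrACA (mulrACA (u 0 a)).
Qed.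

Lemma sum_of_pure_act T r :
  sum_of_pure T r -> sum_of_pure (tensor_act P Q S T) r.
Proof.
case=> u [v [w ->]].
exists (fun l => u l *m P), (fun l => v l *m Q), (fun l => w l *m S).
by rewrite linear_sum; apply: eq_bigr => l _; exact: tensor_act_pure.
Qed.

Lemma cvg_tensor_act (Ts : nat -> tensor K m) T :
    (forall x, Ts t x @[t --> \oo] --> T x) ->
  forall x, tensor_act P Q S (Ts t) x @[t --> \oo] --> tensor_act P Q S T x.
Proof.
move=> cT x; rewrite sum_ffunE; under eq_cvg do rewrite sum_ffunE.
apply: cvg_big => [|y _]; first exact: add_continuous.
rewrite ffunE; under eq_cvg do rewrite ffunE.
by apply: cvgM; [exact: cT|exact: cvg_cst].
Qed.

End TensorAction.

Lemma tensor_actM (K : numFieldType) m (P Q S P' Q' S' : 'M[K]_m)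
    (T : tensor K m) :
  tensor_act P' Q' S' (tensor_act P Q S T) =
  tensor_act (P *m P') (Q *m Q') (S *m S') T.
Proof.
rewrite [tensor_act P Q S T]/tensor_act linear_sum; apply: eq_bigr => x _.
by rewrite linearZ /= tensor_act_pure -!row_mul.
Qed.

(** Rank exactly [r] of the approximants is turned into an expression with [r] pure tensors, the
    form in which [slice_strassen_lim] takes them. *)
Lemma border_rank_lim (K : numFieldType) m (T : tensor K m) :
  exists2 Ts : nat -> tensor K m,
    forall t, sum_of_pure (Ts t) (border_rank T) &
    forall x, Ts t x @[t --> \oo] --> T x.
Proof.
rewrite /border_rank; case: ex_minnP => r /asboolP[Ts Tsr cT] _.
exists Ts => // t; rewrite -(Tsr t) /tensor_rank.
by case: ex_minnP => s /asboolP.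
Qed.

(** * Skeletal tensors in coordinates *)

Section SkeletalForms.
Variables (K : numFieldType) (q : nat).
Local Notation m := q.+2.
Local Notation std := (std_basis K q).
Local Notation e := (fun i : 'I_m => delta_mx 0 i : 'rV[K]_m).
Implicit Types (a b c : m.-tuple 'rV[K]_m) (B : 'M[K]_q).

Lemma midP (i : 'I_m) : [\/ i = ord0, i = ord_max | exists rho, i = mid rho].
Proof.
case: (unliftP ord0 i) => [j ->|->]; last by constructor 1.
case: (unliftP ord_max j) => [rho ->|->]; first by constructor 3; exists rho.
by constructor 2; apply: val_inj.
Qed.

Lemma mid_inj : injective (@mid q).
Proof. by move=> rho s /lift_inj/lift_inj. Qed.

Lemma mid_neq0 (rho : 'I_q) : (mid rho == ord0) = false.
Proof. by []. Qed.

Lemma mid_neq_max (rho : 'I_q) : (mid rho == ord_max) = false.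
Proof.
have -> : ord_max = lift ord0 ord_max :> 'I_m by apply: val_inj.
by rewrite (inj_eq (@lift_inj _ ord0)) eq_sym eq_liftF.
Qed.

(** With the middle basis vectors as rows, the sums over [rho] in a skeletal tensor become matrix
    products. *)
Definition mid_mx a : 'M[K]_(q, m) := \matrix_rho tnth a (mid rho).

Lemma skeletal_formE a b c B i j k :
  skeletal_form a b c B (i, j, k) =
    tnth a ord0 0 i * tnth b ord0 0 j * tnth c ord_max 0 k
  + tnth a ord0 0 i * tnth b ord_max 0 j * tnth c ord0 0 k
  + tnth a ord_max 0 i * tnth b ord0 0 j * tnth c ord0 0 k
  + tnth a ord0 0 i * ((mid_mx b)^T *m mid_mx c) j k
  + tnth b ord0 0 j * ((mid_mx a)^T *m mid_mx c) i k
  + ((mid_mx a)^T *m B *m mid_mx b) i j * tnth c ord0 0 k.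
Proof.
rewrite /skeletal_form !ffunE /=; congr (_ + _ + _ + _).
- rewrite sum_ffunE mxE big_distrr /=; apply: eq_bigr => rho _.
  by rewrite ffunE !mxE mulrA.
- rewrite sum_ffunE mxE big_distrr /=; apply: eq_bigr => rho _.
  by rewrite ffunE !mxE mulrA (mulrC (tnth b _ _ _)).
rewrite sum_ffunE mxE mulr_suml.
under [RHS]eq_bigr do rewrite !mxE !mulr_suml.
rewrite exchange_big /=; apply: eq_bigr => rho _.
rewrite sum_ffunE; apply: eq_bigr => s _.
by rewrite !ffunE !mxE /GRing.scale /= !mulrA (mulrC (B _ _)).
Qed.

Lemma tensor_act_skeletal (P Q S : 'M[K]_m) a b c B :
  tensor_act P Q S (skeletal_form a b c B) =
  skeletal_form (map_tuple (mulmxr P) a) (map_tuple (mulmxr Q) b)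
    (map_tuple (mulmxr S) c) B.
Proof.
rewrite /skeletal_form !linearD /= !linear_sum /= !tensor_act_pure !tnth_map.
congr (_ + _ + _ + _).
- by apply: eq_bigr => rho _; rewrite tensor_act_pure !tnth_map.
- by apply: eq_bigr => rho _; rewrite tensor_act_pure !tnth_map.
apply: eq_bigr => rho _; rewrite linear_sum /=; apply: eq_bigr => s _.
by rewrite linearZ /= tensor_act_pure !tnth_map.
Qed.

Lemma basis_to_std a : basis_of fullv a ->
  exists2 P : 'M[K]_m, P \in unitmx & map_tuple (mulmxr P) a = std.
Proof.
move=> basis_a; pose A : 'M[K]_m := \matrix_i tnth a i.
(* Row [i] of [C] holds the coordinates of [e i] in the basis [a], so [C *m A] is the identity. *)
pose C : 'M[K]_m := \matrix_(i, j) coord a j (e i).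
have [_ uA] : C \in unitmx /\ A \in unitmx.
  apply: mulmx1_unit; apply/row_matrixP => i; rewrite row_mul row1.
  rewrite [RHS](coord_basis basis_a (memvf _)) mulmx_sum_row.
  by apply: eq_bigr => j _; rewrite !mxE rowK (tnth_nth 0).
exists (invmx A); first by rewrite unitmx_inv.
apply: eq_from_tnth => i; rewrite tnth_map tnth_mktuple /=.
by rewrite -[tnth a i](rowK (tnth a)) -row_mul mulmxV // row1.
Qed.

Local Notation E := (mid_mx std).

Lemma mid_mxE rho k : E rho k = (k == mid rho)%:R.
Proof. by rewrite mxE tnth_mktuple mxE. Qed.

Lemma mid_mx_tr0 p (X : 'M[K]_(q, p)) k : (E^T *m X) ord0 k = 0.
Proof. by rewrite mxE big1 // => s _; rewrite mxE mid_mxE mul0r. Qed.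

Lemma mid_mx_tr_max p (X : 'M[K]_(q, p)) k : (E^T *m X) ord_max k = 0.
Proof.
by rewrite mxE big1 // => s _; rewrite mxE mid_mxE eq_sym mid_neq_max mul0r.
Qed.

Lemma mid_mx_tr_mid p (X : 'M[K]_(q, p)) rho k :
  (E^T *m X) (mid rho) k = X rho k.
Proof.
rewrite mxE (bigD1 rho) //= big1 => [|s s_rho]; rewrite !mxE tnth_mktuple mxE.
  by rewrite !eqxx mul1r addr0.
by rewrite (inj_eq mid_inj) eq_sym (negPf s_rho) mul0r.
Qed.

Lemma mul_mid_mx0 p (X : 'M[K]_(p, q)) k : (X *m E) k ord0 = 0.
Proof. by rewrite -[X *m E]trmxK trmx_mul mxE mid_mx_tr0. Qed.

Lemma mul_mid_mx_mid p (X : 'M[K]_(p, q)) rho k :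
  (X *m E) k (mid rho) = X k rho.
Proof. by rewrite -[X *m E]trmxK trmx_mul mxE mid_mx_tr_mid mxE. Qed.

(** * Slices of a skeletal tensor in the standard bases *)

Section Slices.
Variable B : 'M[K]_q.
Local Notation T := (skeletal_form std std std B).

Lemma slice_stdE i j k : slice T i j k =
    (i == ord0)%:R * (j == ord0)%:R * (k == ord_max)%:R
  + (i == ord0)%:R * (j == ord_max)%:R * (k == ord0)%:R
  + (i == ord_max)%:R * (j == ord0)%:R * (k == ord0)%:R
  + (i == ord0)%:R * (E^T *m E) j k + (j == ord0)%:R * (E^T *m E) i k
  + (E^T *m (B *m E)) i j * (k == ord0)%:R.
Proof.
by rewrite mxE skeletal_formE !tnth_mktuple -mulmxA ![delta_mx _ _ _ _]mxE.
Qed.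

Let slice_simp := (mid_mx_tr0, mid_mx_tr_max, mid_mx_tr_mid, mul_mid_mx0,
  mul_mid_mx_mid, mid_mxE, mid_neq0, mid_neq_max, eqxx, mulr0, mul0r, mulr1,
  mul1r, add0r, addr0).

Lemma row0_slice_mid rho : row ord0 (slice T (mid rho)) = e (mid rho).
Proof. by apply/rowP => k; rewrite mxE slice_stdE !slice_simp mxE. Qed.

Lemma slice_mid0 rho s : slice T (mid s) (mid rho) ord0 = B s rho.
Proof. by rewrite slice_stdE !slice_simp. Qed.

Lemma row0_slice0 : row ord0 (slice T ord0) = e ord_max.
Proof. by apply/rowP => k; rewrite mxE slice_stdE !slice_simp mxE. Qed.

Lemma row_max_slice0 : row ord_max (slice T ord0) = e ord0.
Proof. by apply/rowP => k; rewrite mxE slice_stdE !slice_simp mxE. Qed.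

Lemma row_mid_slice0 rho : row (mid rho) (slice T ord0) = e (mid rho).
Proof. by apply/rowP => k; rewrite mxE slice_stdE !slice_simp mxE. Qed.

(** This slice exchanges the first and last basis vectors and fixes the middle ones, so it is its
    own inverse. *)
Lemma slice0_unit : slice T ord0 \in unitmx.
Proof.
suff /mulmx1_unit[] : slice T ord0 *m slice T ord0 = 1%:M by [].
apply/row_matrixP => i; rewrite row_mul row1.
case: (midP i) => [->|->|[rho ->]].
- by rewrite row0_slice0 -rowE row_max_slice0.
- by rewrite row_max_slice0 -rowE row0_slice0.
- by rewrite row_mid_slice0 -rowE row_mid_slice0.
Qed.

(** Row [ord0] of [slice T (mid rho)] is [e (mid rho)], which the inverse of [slice T ord0] fixes;
    row [ord0] of the product is thus row [mid rho] of [slice T (mid s)]. *)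
Lemma slice_product rho s :
  (slice T (mid rho) *m invmx (slice T ord0) *m slice T (mid s)) ord0 ord0 =
  B s rho.
Proof.
have inv_mid : e (mid rho) *m invmx (slice T ord0) = e (mid rho).
  by rewrite -{1}row_mid_slice0 rowE mulmxK ?slice0_unit.
rewrite -slice_mid0; set M := slice T (mid s).
transitivity (row ord0 (slice T (mid rho) *m invmx (slice T ord0) *m M) 0 ord0).
  by rewrite [RHS]mxE.
by rewrite !row_mul row0_slice_mid inv_mid -rowE mxE.
Qed.

End Slices.

(** The approximants are carried to the standard bases along with the tensor; there Strassen's
    identity for [mid rho], [ord0], [mid s], read at row and column [ord0], compares [B s rho] with
    [B rho s]. *)
Lemma border_rank_skeletal_sym a b c B :
    basis_of fullv a -> basis_of fullv b -> basis_of fullv c ->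
    (border_rank (skeletal_form a b c B) <= m)%N ->
  B^T = B.
Proof.
move=> /basis_to_std[P _ aP] /basis_to_std[Q _ bQ] /basis_to_std[S _ cS] le_m.
have [Ts Tsr cT] := border_rank_lim (skeletal_form a b c B).
have := cvg_tensor_act (P := P) (Q := Q) (S := S) cT.
rewrite tensor_act_skeletal aP bQ cS => cT0.
apply/matrixP => s rho; rewrite mxE -!slice_product.
rewrite (slice_strassen_lim _ _ _ cT0 le_m (slice0_unit B)) // => t.
exact: sum_of_pure_act.
Qed.

(* The identity on the first and last basis vectors, G on the middle ones. *)
Definition mid_block (G : 'M[K]_q) : 'M[K]_m := 1%:M + E^T *m (G - 1%:M) *m E.

Lemma mid_mxK : E *m E^T = 1%:M.
Proof.
apply/row_matrixP => s; rewrite row_mul rowK tnth_mktuple -rowE.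
by apply/rowP => rho; rewrite -[E^T]mulmx1 [LHS]mxE mid_mx_tr_mid [RHS]mxE.
Qed.

Lemma mid_block1 : mid_block 1%:M = 1%:M.
Proof. by rewrite /mid_block subrr mulmx0 mul0mx addr0. Qed.

Lemma mid_blockM G H : mid_block G *m mid_block H = mid_block (G *m H).
Proof.
rewrite /mid_block.
(* With [X = G - 1] and [Y = H - 1], expanding the product of the two blocks with [E *m E^T = 1]
   leaves [Y + (X + X *m Y)] in the middle. *)
have -> : G *m H - 1%:M = (H - 1%:M) + ((G - 1%:M) + (G - 1%:M) *m (H - 1%:M)).
  rewrite mulmxBl mulmxBr mulmx1 mul1mx [RHS]addrA [X in _ = X + _]addrC.
  rewrite -[RHS]addrA [X in _ = _ + X]addrC subrK.
  by rewrite [RHS]addrC [RHS]addrA subrK.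
move: (G - 1%:M) (H - 1%:M) => X Y.
rewrite mulmxDl !mulmxDr !mulmx1 !mul1mx !mulmxDl -!addrA !mulmxA.
by rewrite -[_ *m E *m _]mulmxA mid_mxK mulmx1.
Qed.

Lemma mid_block_unit G : G \in unitmx -> mid_block G \in unitmx.
Proof.
move=> uG; have /mulmx1_unit[] // : mid_block G *m mid_block (invmx G) = 1%:M.
by rewrite mid_blockM mulmxV // mid_block1.
Qed.

Lemma std_mid_block0 G :
  tnth (map_tuple (mulmxr (mid_block G)) std) ord0 = e ord0.
Proof.
rewrite tnth_map tnth_mktuple /= mulmxDr mulmx1 -[X in _ *m X]mulmxA -rowE.
by apply/rowP => k; rewrite mxE [X in _ + X]mxE mid_mx_tr0 addr0.
Qed.

Lemma std_mid_block_max G :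
  tnth (map_tuple (mulmxr (mid_block G)) std) ord_max = e ord_max.
Proof.
rewrite tnth_map tnth_mktuple /= mulmxDr mulmx1 -[X in _ *m X]mulmxA -rowE.
by apply/rowP => k; rewrite mxE [X in _ + X]mxE mid_mx_tr_max addr0.
Qed.

Lemma mid_mx_map a (P : 'M[K]_m) :
  mid_mx (map_tuple (mulmxr P) a) = mid_mx a *m P.
Proof. by apply/row_matrixP => rho; rewrite row_mul !rowK tnth_map. Qed.

Lemma mid_mx_std_block G : E *m mid_block G = G *m E.
Proof.
rewrite mulmxDr mulmx1 !mulmxA mid_mxK mul1mx mulmxBl mul1mx addrC subrK //.
Qed.

(** The condition makes [H] the inverse transpose of [G], which preserves the pairings of the middle
    vectors of C with those of A and B; only the form changes, by congruence. *)
Lemma tensor_act_mid_block G H B :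
    G^T *m H = 1%:M ->
  tensor_act (mid_block G) (mid_block G) (mid_block H)
    (skeletal_form std std std B) =
  skeletal_form std std std (G^T *m B *m G).
Proof.
move=> GH; rewrite tensor_act_skeletal; apply/ffunP => -[[i j] k].
rewrite !skeletal_formE !std_mid_block0 !std_mid_block_max !mid_mx_map.
rewrite !mid_mx_std_block !trmx_mul !tnth_mktuple.
have -> : E^T *m G^T *m (H *m E) = E^T *m E.
  by rewrite mulmxA -(mulmxA _ _ H) GH mulmx1.
by rewrite !mulmxA.
Qed.

End SkeletalForms.

(** * Normal form for symmetric skeletal tensors *)

Lemma sym_skeletal_isomorphic (K : numClosedFieldType) q
    (a b c : q.+2.-tuple 'rV[K]_q.+2) (B : 'M[K]_q) :
    basis_of fullv a -> basis_of fullv b -> basis_of fullv c ->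
    B \in unitmx -> B^T = B ->
  isomorphic (skeletal_form a b c B) (big_CW K q).
Proof.
move=> /basis_to_std[P uP aP] /basis_to_std[Q uQ bQ] /basis_to_std[S uS cS].
move=> uB symB; have [H HB] := sym_unitmx_congr1 symB uB.
have [_ uHT] := mulmx1_unit HB.
have uH : H \in unitmx by rewrite -unitmx_tr.
(* [P], [Q], [S] pass to the standard bases. With [G = H^T] the congruence of [tensor_act_mid_block]
   is [H *m B *m H^T = 1], and [invmx H] is the inverse transpose of [G]. *)
exists (P *m mid_block H^T), (Q *m mid_block H^T), (S *m mid_block (invmx H)).
split; rewrite ?unitmx_mul ?mid_block_unit ?unitmx_inv ?andbT //.
rewrite -tensor_actM tensor_act_skeletal aP bQ cS tensor_act_mid_block.
  by rewrite trmxK HB.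
by rewrite trmxK mulmxV.
Qed.

Theorem proposition7p2 (R : realType) (q : nat) (T : tensor R[i] q.+2) :
  skeletal T -> ~ isomorphic T (big_CW R[i] q) -> (q.+2 + 1 <= border_rank T)%N.
Proof.
case=> a [b [c [B [basis_a basis_b basis_c rankB ->]]]] niso.
(* Border rank at most [q.+2] makes [B] symmetric, which puts the tensor in the excluded orbit. *)
rewrite addn1 ltnNge; apply/negP => le_m; apply: niso.
apply: sym_skeletal_isomorphic => //; last exact: border_rank_skeletal_sym le_m.
by rewrite -row_full_unit /row_full rankB.
Qed.
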